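(* Assume the hypotheses of Theorem 1 (Assumption 1 with $\delta\in(0,1]$, $A\ge1$, $\alpha$, $r=A\sqrt{2\log(L)/n}$, $L\le\exp(d_{n,\delta}^2/(2A^2))$) and Assumptions 2, 4 and 5 (the latter for an integer $s\ge1$). Assume $|J(\beta^* )|\le s$ and $|\beta^*_k|>\frac{4\sigma_*r\tau^*(s)}{c^*_k(s)v_k}$ for all $k\in J(\beta^* )$. Let $(\widehat\beta,\widehat\sigma)$ be any STIV solution, define the thresholds $$\omega_k(s)=\frac{2\widehat\sigma r}{\kappa^*_k(s)x_{k*}}\left(1-\frac{r}{\kappa^*_{J_{\rm end}}(s)}-\frac{r^2}{\kappa^*_{J^c_{\rm end}}(s)}\right)_+^{-1},$$ and let $\widetilde\beta$ have coordinates $\widetilde\beta_k=\widehat\beta_k$ if $|\widehat\beta_k|>\omega_k(s)$ and $\widetilde\beta_k=0$ otherwise. Then with probability at least $1-\gamma$, $({\rm sign}(\widetilde\beta_1),\dots,{\rm sign}(\widetilde\beta_K))=({\rm sign}(\beta^*_1),\dots,{\rm sign}(\beta^*_K))$; in particular $J(\widetilde\beta)=J(\beta^* )$.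
   Context: Setting: integers $n,K,L$ with $L\ge K$, $k_{\rm end}\in\{0,\dots,K\}$; observations $(y_i,x_i,z_i)$, $i=1,\dots,n$, with $y_i=x_i^T\beta^*+u_i$, $x_i\in\mathbb R^K$, $z_i\in\mathbb R^L$, the $(y_i,x_i,z_i,u_i)$ mutually independent; $J_{\rm end}=\{1,\dots,k_{\rm end}\}$, $J_{\rm end}^c$ its complement, $z_{li}=x_{(k_{\rm end}+l)i}$ for $l\le K-k_{\rm end}$. ${\bf Y},{\bf X},{\bf Z}$ the data matrices; $x_{k*}=\max_i|x_{ki}|$, $z_{l*}=\max_i|z_{li}|$; ${\bf D_X}={\rm diag}(x_{k*}^{-1})$, ${\bf D_Z}={\rm diag}(z_{l*}^{-1})$; $\Psi_n=\frac1n{\bf D_Z}{\bf Z}^T{\bf X}{\bf D_X}$; $\widehat Q(\beta)=\frac1n\sum(y_i-x_i^T\beta)^2$; $\mathbb E_n[U^2]=\frac1n\sum u_i^2$. $J(\beta)$ is the support, ${\rm sign}(t)\in\{-1,0,1\}$; $\Delta_J$ zeroes coordinates outside $J$; $(a)_+^{-1}=1/\max(a,0)$, $a/0=\infty$ for $a>0$, $1/\infty=0$. For $c\in(0,1)$: $C_J=\{\Delta:|\Delta_{J^c}|_1\le\frac{1+c}{1-c}|\Delta_J|_1\}$, $\kappa^*_{J_0,J}=\inf\{|\Psi_n\Delta|_\infty:\Delta\in C_J,|\Delta_{J_0}|_1=1\}$ ($=\infty$ if $J_0=\varnothing$). With $a=\frac{2s}{1-c}$: $\kappa^*_{J_0}(s)=\min_{j}\inf\{|\Psi_n\Delta|_\infty: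 |\Delta_{J_0}|_1=1,\ |\Delta|_1\le a|\Delta_j|\}$ and $\kappa^*_k(s)=\kappa^*_{\{k\}}(s)$ (for $J_0=\varnothing$ set $\kappa^*_\varnothing(s)=\infty$). STIV estimator: any minimizer $(\widehat\beta,\widehat\sigma)$ of $|{\bf D_X}^{-1}\beta|_1+c\sigma$ over $\{(\beta,\sigma):\sigma>0,|\frac1n{\bf D_Z}{\bf Z}^T({\bf Y}-{\bf X}\beta)|_\infty\le\sigma r,\widehat Q(\beta)\le\sigma^2\}$. Assumption 1: for all $i,l$, $\mathbb E|z_{li}u_i|^{2+\delta}<\infty$, $\mathbb E[z_{li}u_i]=0$, $z_{li}u_i$ not a.s. zero; $d_{n,\delta}=\min_l\sqrt{\sum_i\mathbb E z_{li}^2u_i^2}/(\sum_i\mathbb E|z_{li}u_i|^{2+\delta})^{1/(2+\delta)}$; $\alpha=2L\{1-\Phi(A\sqrt{2\log L})\}+2A_0(1+A\sqrt{2\log L})^{1+\delta}/(L^{A^2-1}d_{n,\delta}^{2+\delta})$, $\Phi$ standard normal cdf, $A_0$ the absolute constant of the Jing–Shao–Wang self-normalized moderate deviation bound. Assumption 2: $\mathbb P(\mathbb E_n[U^2]\le\sigma_*^2)\ge1-\gamma_1$ for some $\sigma_*>0,\gamma_1\in(0,1)$. Assumption 4: $\mathbb P(x_{k*}\ge v_k\ \forall k\in J(\beta^* ))\ge1-\gamma_3$ for some $v_k>0$, $\gamma_3\in(0,1)$. Assumption 5: there are constants $c^*_{J(\beta^* )}>0$, $c^*_{J_0}(s)>0$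 and $\gamma_2\in(0,1)$ such that with probability at least $1-\gamma_2$, $\kappa^*_{J(\beta^* ),J(\beta^* )}\ge c^*_{J(\beta^* )}$ and $\kappa^*_{J_0}(s)\ge c^*_{J_0}(s)$ for $J_0=\{k\}$ (all $k$), $J_0=J_{\rm end}$ and $J_0=J^c_{\rm end}$; $c^*_k(s):=c^*_{\{k\}}(s)$. $\gamma=\alpha+\gamma_1+\gamma_2+\gamma_3$; $\tau^*(s)=\big(1+\frac{r}{c\,c^*_{J(\beta^* )}}\big)\big(1-\frac{r}{c\,c^*_{J(\beta^* )}}\big)_+^{-1}\big(1-\frac{r}{c^*_{J_{\rm end}}(s)}-\frac{r^2}{c^*_{J^c_{\rm end}}(s)}\big)_+^{-1}$. *)

(* Defs.v *)
From HB Require Import structures.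
From mathcomp Require Import all_boot all_order all_algebra.
From mathcomp Require Import all_classical all_reals all_analysis.
Set Implicit Arguments. Unset Strict Implicit. Unset Printing Implicit Defensive.
Import Order.TTheory GRing.Theory Num.Theory.
Import numFieldNormedType.Exports.
Local Open Scope classical_set_scope.
Local Open Scope ring_scope.

Section STIVdefs.
Context {R : realType}.

(* einv a = 1 / max(a,0), with 1/0 = +oo and 1/+oo = 0.  This implements
   both (a)_+^{-1} and b/a = b * einv a (for a >= 0). *)
Definition einv (a : \bar R) : \bar R :=
  match a with
  | EFin r => if 0 < r then (r^-1)%:E else +oo%E
  | +oo%E => 0%E
  | -oo%E => +oo%E
  end.

Definition Phi (t : R) : R := fine (normal_prob 0 1 `]-oo, t]).

Definition l1norm {K : nat} (J : {set 'I_K}) (D : 'I_K -> R) : R :=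
  \sum_(k in J) `|D k|.
Definition linfnorm {L : nat} (v : 'I_L -> R) : R :=
  \big[Num.max/0]_(l < L) `|v l|.
Definition mulmv {L K : nat} (M : 'I_L -> 'I_K -> R) (D : 'I_K -> R) : 'I_L -> R :=
  fun l => \sum_(k < K) M l k * D k.
Definition supp {K : nat} (b : 'I_K -> R) : {set 'I_K} := [set k | b k != 0].

Definition coneC {K : nat} (c : R) (J : {set 'I_K}) : set ('I_K -> R) :=
  [set D | l1norm (~: J) D <= (1 + c) / (1 - c) * l1norm J D].

Definition kappaJJ {L K : nat} (Psi : 'I_L -> 'I_K -> R) (c : R)
    (J0 J : {set 'I_K}) : \bar R :=
  if J0 == finset.set0 then +oo%E else
  ereal_inf [set (linfnorm (mulmv Psi D))%:E |
               D in [set D | coneC c J D /\ l1norm J0 D = 1]].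

Definition kappas {L K : nat} (Psi : 'I_L -> 'I_K -> R) (c : R) (s : nat)
    (J0 : {set 'I_K}) : \bar R :=
  if J0 == finset.set0 then +oo%E else
  \big[Order.min/+oo%E]_(j < K)
    ereal_inf [set (linfnorm (mulmv Psi D))%:E |
                 D in [set D | l1norm J0 D = 1 /\
                       l1norm [set: 'I_K]%SET D <= (2 * s%:R / (1 - c)) * `|D j|]].

Definition colmax {n K : nat} (X : 'I_n -> 'I_K -> R) (k : 'I_K) : R :=
  \big[Num.max/0]_(i < n) `|X i k|.

(* Psi_n = (1/n) D_Z Z^T X D_X *)
Definition PsiN {n K L : nat} (X : 'I_n -> 'I_K -> R) (Z : 'I_n -> 'I_L -> R)
    : 'I_L -> 'I_K -> R :=
  fun l k => n%:R^-1 * \sum_(i < n)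
     ((colmax Z l)^-1 * Z i l * X i k * (colmax X k)^-1).

Definition resid {n K : nat} (Y : 'I_n -> R) (X : 'I_n -> 'I_K -> R)
    (b : 'I_K -> R) (i : 'I_n) : R := Y i - \sum_(k < K) X i k * b k.

Definition Qhat {n K : nat} (Y : 'I_n -> R) (X : 'I_n -> 'I_K -> R)
    (b : 'I_K -> R) : R := n%:R^-1 * \sum_(i < n) (resid Y X b i) ^+ 2.

Definition STIV_feasible {n K L : nat} (r : R) (Y : 'I_n -> R)
    (X : 'I_n -> 'I_K -> R) (Z : 'I_n -> 'I_L -> R) (b : 'I_K -> R) (sg : R) : Prop :=
  [/\ 0 < sg,
      linfnorm (fun l => n%:R^-1 * (colmax Z l)^-1 *
                 \sum_(i < n) Z i l * resid Y X b i) <= sg * r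
    & Qhat Y X b <= sg ^+ 2].

Definition STIV_obj {n K : nat} (c : R) (X : 'I_n -> 'I_K -> R)
    (b : 'I_K -> R) (sg : R) : R :=
  \sum_(k < K) colmax X k * `|b k| + c * sg.

Definition is_STIV {n K L : nat} (c r : R) (Y : 'I_n -> R)
    (X : 'I_n -> 'I_K -> R) (Z : 'I_n -> 'I_L -> R) (bh : 'I_K -> R) (sh : R) : Prop :=
  STIV_feasible r Y X Z bh sh /\
  forall b sg, STIV_feasible r Y X Z b sg ->
    STIV_obj c X bh sh <= STIV_obj c X b sg.

Definition omega_thr {n K L : nat} (c r : R) (s kend : nat)
    (X : 'I_n -> 'I_K -> R) (Z : 'I_n -> 'I_L -> R) (sh : R) (k : 'I_K) : \bar R :=
  let Psi := PsiN X Z in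
  let Jend := [set j : 'I_K | (j < kend)%N]%SET in
  ((2 * sh * r)%:E
   * einv (kappas Psi c s [set k]%SET * (colmax X k)%:E)
   * einv (1%:E - r%:E * einv (kappas Psi c s Jend)
               - (r ^+ 2)%:E * einv (kappas Psi c s (~: Jend))))%E.

Definition thresholded {n K L : nat} (c r : R) (s kend : nat)
    (X : 'I_n -> 'I_K -> R) (Z : 'I_n -> 'I_L -> R) (bh : 'I_K -> R) (sh : R)
    (k : 'I_K) : R :=
  if (omega_thr c r s kend X Z sh k < (`|bh k|)%:E)%E then bh k else 0.

Definition tau_star (c r cJ cend cendc : R) : \bar R :=
  ((1 + r / (c * cJ))%:E * einv (1 - r / (c * cJ))%:E
    * einv (1 - r / cend - r ^+ 2 / cendc)%:E)%E.

End STIVdefs.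

Section Prob.
Context {R : realType} {d : measure_display} {T : measurableType d}.

Definition sigma_of (fs : set (T -> R)) : set (set T) :=
  <<s [set A | exists f B, [/\ fs f, measurable B & A = f @^-1` B]] >>.

(* mutual independence of a finite family of sigma-algebras (product rule;
   subfamilies are obtained by choosing A i = setT) *)
Definition mutually_indep (P : probability T R) (n : nat)
    (G : 'I_n -> set (set T)) : Prop :=
  forall A : 'I_n -> set T, (forall i, G i (A i)) ->
    P (\bigcap_(i in [set: 'I_n]) A i) = (\prod_(i < n) P (A i))%E.

Definition mom2 (P : probability T R) (X : T -> R) : R :=
  fine (\int[P]_w ((X w) ^+ 2)%:E)%E.
Definition momp (P : probability T R) (X : T -> R) (p : R) : R :=
  fine (\int[P]_w ((`|X w| `^ p)%:E))%E.

Definition dnd1 (P : probability T R) (n : nat) (X : 'I_n -> T -> R) (delta : R) : R :=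
  Num.sqrt (\sum_(i < n) mom2 P (X i)) /
  (\sum_(i < n) momp P (X i) (2 + delta)) `^ (1 / (2 + delta)).

End Prob.

(* A0 is a valid constant in the Jing--Shao--Wang (2003) self-normalized
   moderate deviation bound:  for independent mean-zero X_i with finite
   (2+delta)-th moments, 0 < delta <= 1, and 0 <= t <= d_{n,delta},
   | P(S_n >= t V_n) / (1 - Phi(t)) - 1 | <= A0 ((1+t)/d_{n,delta})^{2+delta}. *)
Definition JSW_constant {R : realType} (A0 : R) : Prop :=
  forall (d : measure_display) (T : measurableType d) (P : probability T R)
         (n : nat) (X : 'I_n -> T -> R) (delta : R),
  (0 < n)%N -> 0 < delta <= 1 ->
  (forall i, measurable_fun setT (X i)) ->
  mutually_indep P (fun i => sigma_of [set X i]) ->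
  (forall i, ((\int[P]_w (X i w)%:E) = 0)%E) ->
  (forall i, (\int[P]_w ((`|X i w| `^ (2 + delta)%R)%:E) < +oo)%E) ->
  (forall i, (0 < P [set w | (X i w != 0)%R])%E) ->
  forall t, 0 <= t <= dnd1 P X delta ->
  `| fine (P [set w | t * Num.sqrt (\sum_(i < n) X i w ^+ 2) <= \sum_(i < n) X i w])
       / (1 - Phi t) - 1 |
    <= A0 * ((1 + t) / dnd1 P X delta) `^ (2 + delta).

(* Main.v *)
(* Self-normalized sums: the moderate deviation bound, applied to the products
   z_li u_i and their opposites and summed over l, gives with probability at
   least 1 - alpha the score bound |E_n[z_l U]| <= r sqrt(E_n[z_l^2 U^2]) for all
   l; the exact form of alpha comes from (1 + t)(1 - Phi t) <= exp(-t^2/2) at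
   t = A sqrt(2 log L).
   On that event beta* is feasible at every sigma > q := sqrt(E_n[U^2]), so
   minimality of the STIV objective puts Delta = D_X^-1 (bh - beta* ) in the cone
   and yields |Psi Delta|_oo <= r (sh + q), sh <= q (1 + rho)/(1 - rho) with
   rho = r/(c cJ), and, by convexity of the root mean square,
   q - sh <= |Delta_Jend|_1 + r |Delta_Jend^c|_1.  The sensitivities turn these
   into |bh_k - beta*_k| <= omega_k, and the beta-min condition says
   |beta*_k| > 2 omega_k on the support.
   When L = 1, r = 0 and the thresholds degenerate, but then alpha >= 1. *)
Require Import Defs.
From HB Require Import structures.
From mathcomp Require Import all_boot all_order all_algebra.
From mathcomp Require Import all_classical all_reals all_analysis.
From mathcomp Require Import measurable_realfun ring lra.
Set Implicit Arguments. Unset Strict Implicit. Unset Printing Implicit Defensive.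
Import Order.TTheory GRing.Theory Num.Theory.
Import numFieldNormedType.Exports.
Local Open Scope classical_set_scope.
Local Open Scope ring_scope.

(** * Gaussian tail *)

Section GaussianTail.
Context {R : realType}.
Local Notation mu := (@lebesgue_measure R).

Lemma std_normal_pdfE (x : R) :
  normal_pdf 0 1 x = (Num.sqrt (pi *+ 2))^-1 * expR (- (x ^+ 2 / 2)).
Proof.
by rewrite normal_pdfE // /normal_peak /normal_fun expr1n mul1r subr0 mulNr.
Qed.

Lemma one_minus_Phi (t : R) :
  (1 - Phi t)%:E = (\int[mu]_(x in `]t, +oo[) (normal_pdf 0 1 x)%:E)%E.
Proof.
rewrite EFinB /Phi fineK ?fin_num_measure//.
have -> : (1 : \bar R)%E = normal_prob 0 1 setT by rewrite probability_setT.
by rewrite -/(normal_prob 0 1 `]t, +oo[%classic) -setCitvl probability_setC// probability_setT.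
Qed.

(** On []t, t + 1]] the density is at least its value at [|t| + 1], so the tail has positive mass.
    This permits clearing the denominator [1 - Phi t] in the moderate deviation bound. *)
Lemma Phi_lt1 (t : R) : 0 < 1 - Phi t.
Proof.
rewrite -lte_fin one_minus_Phi.
have h0 : 0 < normal_pdf 0 1 (`|t| + 1).
  by rewrite std_normal_pdfE mulr_gt0 ?expR_gt0// invr_gt0 sqrtr_gt0 pmulrn_lgt0 ?pi_gt0.
pose I := `]t, t + 1]%classic; pose m := normal_pdf 0 1 (`|t| + 1) : R.
have sub : I `<=` `]t, +oo[ by move=> x /=; rewrite !in_itv /= andbT => /andP[].
apply: (@lt_le_trans _ _ (\int[mu]_(x in I) m%:E)%E).
  rewrite integral_cst; last exact: measurable_itv.
  rewrite /I /= lebesgue_measure_itv /= lte_fin ltrDl ltr01 -EFinD addrAC subrr add0r.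
  by rewrite mule1 lte_fin.
apply: (@le_trans _ _ (\int[mu]_(x in I) (normal_pdf 0 1 x)%:E)%E).
  have mI : measurable I by exact: measurable_itv.
  apply: ge0_le_integral => //=.
  - by move=> x _; rewrite lee_fin ltW.
  - by apply/measurable_EFinP/measurable_funTS; exact: measurable_normal_pdf.
  - move=> x; rewrite /I /= in_itv /= => /andP[tx xt]; rewrite lee_fin /m !std_normal_pdfE.
    rewrite ler_wpM2l ?invr_ge0 ?sqrtr_ge0// ler_expR lerN2 ler_pM2r ?invr_gt0//.
    rewrite -[x ^+ 2]real_normK ?num_real// lerXn2r ?nnegrE ?addr_ge0//.
    rewrite ler_norml; apply/andP; split; last by apply: (le_trans xt); rewrite lerD2r ler_norm.
    have := ler_norm (- t); rewrite normrN; lra.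
apply: ge0_subset_integral => //=; first exact: measurable_itv.
  by apply/measurable_EFinP/measurable_funTS; exact: measurable_normal_pdf.
by move=> x _; rewrite lee_fin normal_pdf_ge0.
Qed.

(** Symmetry of the density halves its total mass. The value serves the case [L = 1], where the
    deviation level is 0. *)
Lemma Phi0 : Phi 0 = 1 / 2 :> R.
Proof.
have h := one_minus_Phi 0.
have sym : normal_pdf 0 1 =1 normal_pdf 0 1 \o -%R :> (R -> R).
  by move=> x /=; rewrite !std_normal_pdfE sqrrN.
have := ge0_symfun_integralT (@normal_pdf_ge0 _ 0 1)
  (continuous_normal_pdf (oner_neq0 R)) sym.
rewrite integral_normal_pdf.
rewrite -set_itvcy -integral_itv_obnd_cbnd; last first.
  by apply/measurable_EFinP/measurable_funTS; exact: measurable_normal_pdf.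
rewrite -h -EFinM => /eqP; rewrite eqe => /eqP; lra.
Qed.

(** [- F t] is the target tail bound after division by [1 + t]. On the half-line [f] is the
    derivative of [F] and dominates the Gaussian density. *)
Let F (x : R) : R := - (expR (- (x ^+ 2 / 2)) * (1 + x)^-1).
Let f (x : R) : R := expR (- (x ^+ 2 / 2)) * (x ^+ 2 + x + 1) / (1 + x) ^+ 2.

Let gauss_deriv (x : R) :
  is_derive x 1 (fun x : R => expR (- (x ^+ 2 / 2))) (- x * expR (- (x ^+ 2 / 2))).
Proof. by apply: trigger_derive; rewrite /GRing.scale /=; field. Qed.

Let dF (x : R) : 0 <= x -> is_derive x 1 F (f x).
Proof.
move=> x0; have x1 : 1 + x != 0 by rewrite lt0r_neq0//; lra.
have h1 : is_derive x 1 (fun x : R => (1 + x)^-1) (- (1 + x) ^- 2).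
  have h0 : is_derive x 1 (fun x : R => (1 : R) + x) (1 : R).
    have h := is_deriveD (is_derive_cst (1 : R) x 1) (is_derive_id x 1).
    by apply: (is_derive_eq h); rewrite add0r.
  by apply: (is_derive_eq (is_deriveV x1 h0)); rewrite scaler1.
have h3 := is_deriveN (is_deriveM (gauss_deriv x) h1).
apply: (is_derive_eq h3).
by rewrite /f /GRing.scale /=; field.
Qed.

(** The integral of [f] over [[t, +oo[] is [- F t], since [F] vanishes at infinity; comparing the
    density with [f] pointwise concludes. *)
Lemma Gaussian_tail (t : R) : 0 <= t -> (1 + t) * (1 - Phi t) <= expR (- (t ^+ 2 / 2)).
Proof.
move=> t0; have t1 : 0 < 1 + t by lra.
have dF' x : t < x -> is_derive x 1 F (f x) by move=> tx; apply: dF; lra.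
have f0 x : t <= x -> 0 <= f x.
  move=> tx; rewrite /f divr_ge0 ?sqr_ge0// mulr_ge0 ?expR_ge0//.
    by have := sqr_ge0 x; lra.
have cf : {within `[t, +oo[, continuous f}.
  apply: continuous_in_subspaceT => x; rewrite inE /= in_itv /= andbT => tx.
  have x1 : 1 + x != 0 by rewrite lt0r_neq0//; lra.
  apply: cvgM; last first.
    apply: cvgV; first by rewrite expf_neq0.
    apply: (@continuous_comp _ _ _ (fun x : R => 1 + x) (fun x => x ^+ 2)); last exact: exprn_continuous.
    by apply: cvgD; [exact: cvg_cst|exact: cvg_id].
  have cg : {for x, continuous (fun x : R => expR (- (x ^+ 2 / 2)))}.
    by apply/differentiable_continuous/derivable1_diffP; have [] := gauss_deriv x.
  apply: cvgM; first exact: cg.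
  apply: cvgD; last exact: cvg_cst.
  by apply: cvgD; [exact: exprn_continuous|exact: cvg_id].
have key : (\int[mu]_(x in `[t, +oo[) (f x)%:E = 0%:E - (F t)%:E)%E.
  apply: (ge0_continuous_FTC2y f0 cf).
  - rewrite -oppr0; apply: cvgN.
    apply: (@squeeze_cvgr _ _ _ _ (fun=> 0) (fun x : R => expR (- x))); last exact: cvgr_expR.
      near=> x.
      (* From 2 on, [x <= x ^+ 2 / 2], so [- F] is squeezed between 0 and [expR (- x)]. *)
      have x2 : 2 <= x by near: x; exact: nbhs_pinfty_ge.
      rewrite mulr_ge0 ?expR_ge0 ?invr_ge0//=; last lra.
      rewrite ler_pdivrMr; last lra.
      apply: (@le_trans _ _ (expR (- x) * 1)); last by rewrite ler_wpM2l ?expR_ge0//; lra.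
      by rewrite mulr1 ler_expR lerN2; nra.
    exact: cvg_cst.
  - by move=> x tx; have [] := dF' _ tx.
  - have cF : {for t, continuous F}.
      by apply/differentiable_continuous/derivable1_diffP; have [] := dF t0.
    exact: cvg_at_right_filter.
  - move=> x; rewrite in_itv /= andbT => tx; rewrite derive1E.
    by have ? := dF' _ tx; rewrite derive_val.
rewrite mulrC -ler_pdivlMr// -lee_fin one_minus_Phi.
move: key; rewrite /F sub0e -EFinN opprK => <-.
rewrite integral_itv_obnd_cbnd; last first.
  by apply/measurable_EFinP/measurable_funTS; exact: measurable_normal_pdf.
apply: ge0_le_integral => //=.
- by move=> x _; rewrite lee_fin normal_pdf_ge0.
- by apply/measurable_EFinP/measurable_funTS; exact: measurable_normal_pdf.
- by apply/measurable_EFinP; exact: subspace_continuous_measurable_fun.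
- move=> x /=; rewrite in_itv /= andbT => tx.
  rewrite lee_fin std_normal_pdfE /f -mulrA mulrC ler_pM2l ?expR_gt0//.
  (* The two factors are separated by 1/2: the normalizing constant is at most 1/2, and
     [(x^2 + x + 1) / (1 + x)^2] is at least 1/2. *)
  have : 2 <= Num.sqrt (pi *+ 2) :> R.
    rewrite -[2](@gtr0_norm R)// -sqrtr_sqr ler_wsqrtr// expr2 mulr_natr lerMn2r//.
    exact: pi_ge2.
  move=> h2; apply: (@le_trans _ _ (2^-1)); first by rewrite lef_pV2// posrE; lra.
  rewrite ler_pdivlMr; last by rewrite exprn_gt0//; lra.
  nra.
Unshelve. all: by end_near.
Qed.

End GaussianTail.

(** * Self-normalized deviations *)

Section SelfNormalized.
Context {R : realType} {d : measure_display} {T : measurableType d}.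
Variable P : probability T R.

Lemma sigma_of_sub (fs gs : set (T -> R)) :
  (forall g, gs g -> forall B, measurable B -> sigma_of fs (g @^-1` B)) ->
  sigma_of gs `<=` sigma_of fs.
Proof.
move=> h; apply: smallest_sub; first exact: smallest_sigma_algebra.
by move=> _ [g [B [gsg mB ->]]]; exact: h.
Qed.

Lemma mutually_indep_sub (n : nat) (G H : 'I_n -> set (set T)) :
  (forall i, H i `<=` G i) -> mutually_indep P G -> mutually_indep P H.
Proof. by move=> HG indG A HA; apply: indG => i; exact: HG. Qed.

(** Measurability is taken with respect to the sigma-algebra generated by the family itself, so
    closure of measurable functions under products and opposites transfers to [sigma_of];
    independence then passes to the products [z_li u_i]. *)
Lemma sigma_of_measurable_fun (fs : set (T -> R)) (f : T -> R) :
  fs f -> @measurable_fun _ _ (g_sigma_algebraType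
    [set A | exists f B, [/\ fs f, measurable B & A = f @^-1` B]]) R setT f.
Proof.
move=> fsf _ B mB; rewrite setTI; apply: sub_sigma_algebra.
by exists f, B.
Qed.

Lemma sigma_of_mul (fs : set (T -> R)) (f g : T -> R) :
  fs f -> fs g -> sigma_of [set (fun w => f w * g w)] `<=` sigma_of fs.
Proof.
move=> fsf fsg; apply: sigma_of_sub => _ -> B mB.
have := measurable_funM (sigma_of_measurable_fun fsf) (sigma_of_measurable_fun fsg).
by move=> /(_ measurableT _ mB); rewrite setTI.
Qed.

Lemma sigma_of_opp (f : T -> R) : sigma_of [set (fun w => - f w)] `<=` sigma_of [set f].
Proof.
apply: sigma_of_sub => _ -> B mB.
have := measurable_funN (@sigma_of_measurable_fun [set f] f erefl).
by move=> /(_ measurableT _ mB); rewrite setTI.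
Qed.

Lemma dnd1_opp (n : nat) (X : 'I_n -> T -> R) (delta : R) :
  dnd1 P (fun i w => - X i w) delta = dnd1 P X delta.
Proof.
rewrite /dnd1; congr (Num.sqrt _ / _ `^ _); apply: eq_bigr => i _.
  by rewrite /mom2; congr fine; apply: eq_integral => w _; rewrite sqrrN.
by rewrite /momp; congr fine; apply: eq_integral => w _; rewrite normrN.
Qed.

Lemma dnd1_ge0 (n : nat) (X : 'I_n -> T -> R) (delta : R) : 0 <= dnd1 P X delta.
Proof. by rewrite divr_ge0 ?sqrtr_ge0 ?powR_ge0. Qed.

Lemma measurable_selfnorm (n : nat) (X : 'I_n -> T -> R) (t : R) :
  (forall i, measurable_fun setT (X i)) ->
  measurable [set w | t * Num.sqrt (\sum_(i < n) X i w ^+ 2) <= \sum_(i < n) X i w].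
Proof.
move=> mX; rewrite -[X in measurable X]setTI.
apply: (@measurable_fun_le _ _ R setT) => //.
- apply: measurable_funM => //; apply: measurableT_comp => //.
    by apply: continuous_measurable_fun; exact: sqrt_continuous.
  by apply: measurable_sum => i; exact: measurable_funX.
- exact: measurable_sum.
Qed.

Variables (A0 delta : R) (n : nat) (X : 'I_n -> T -> R) (t : R).
Hypotheses (JSW : JSW_constant A0) (n0 : (0 < n)%N) (delta01 : 0 < delta <= 1).
Hypothesis mX : forall i, measurable_fun setT (X i).
Hypothesis indepX : mutually_indep P (fun i => sigma_of [set X i]).
Hypothesis meanX : forall i, (\int[P]_w (X i w)%:E = 0)%E.
Hypothesis momX : forall i, (\int[P]_w (`|X i w| `^ (2 + delta)%R)%:E < +oo)%E.
Hypothesis nzX : forall i, (0 < P [set w | (X i w != 0)%R])%E.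
Hypothesis tX : 0 <= t <= dnd1 P X delta.

Let bound := (1 - Phi t) * (1 + A0 * ((1 + t) / dnd1 P X delta) `^ (2 + delta)).

Lemma JSW_upper_tail :
  (P [set w | (t * Num.sqrt (\sum_(i < n) X i w ^+ 2) <= \sum_(i < n) X i w)%R] <= bound%:E)%E.
Proof.
have := JSW n0 delta01 mX indepX meanX momX nzX tX.
set S := [set w | _]; rewrite ler_distl => /andP[_].
rewrite ler_pdivrMr ?Phi_lt1// => h.
rewrite -(@fineK _ (P S)) ?fin_num_measure//; last exact: measurable_selfnorm.
by rewrite lee_fin /bound mulrC.
Qed.

(** The deviation bound dominates an absolute value and its power factor is positive, so one
    admissible sample fixes the sign of [A0]. *)
Lemma JSW_constant_ge0 : 0 < dnd1 P X delta -> 0 <= A0.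
Proof.
move=> d0; have /andP[t0 _] := tX.
have := le_trans (normr_ge0 _) (JSW n0 delta01 mX indepX meanX momX nzX tX).
rewrite pmulr_lge0// powR_gt0// divr_gt0//; lra.
Qed.

End SelfNormalized.

(** The exceptional set is the union of the upper tail events of [X] and of [- X]; the opposite
    family satisfies the same hypotheses with the same [dnd1]. *)
Lemma selfnorm_two_sided {R : realType} {d : measure_display} {T : measurableType d}
  (P : probability T R) (A0 delta : R) (n : nat) (X : 'I_n -> T -> R) (t : R) :
  JSW_constant A0 -> (0 < n)%N -> 0 < delta <= 1 ->
  (forall i, measurable_fun setT (X i)) ->
  mutually_indep P (fun i => sigma_of [set X i]) ->
  (forall i, (\int[P]_w (X i w)%:E = 0)%E) ->
  (forall i, (\int[P]_w (`|X i w| `^ (2 + delta)%R)%:E < +oo)%E) ->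
  (forall i, (0 < P [set w | (X i w != 0)%R])%E) ->
  0 <= t <= dnd1 P X delta ->
  exists2 B, measurable B &
    (P B <= (2 * ((1 - Phi t) * (1 + A0 * ((1 + t) / dnd1 P X delta) `^ (2 + delta))))%R%:E)%E /\
    forall w, ~ B w -> `|\sum_(i < n) X i w| <= t * Num.sqrt (\sum_(i < n) X i w ^+ 2).
Proof.
move=> JSW n0 delta01 mX indX meanX momX nzX tX.
pose Y i w := - X i w.
have YX w : \sum_(i < n) Y i w ^+ 2 = \sum_(i < n) X i w ^+ 2.
  by apply: eq_bigr => i _; rewrite /Y sqrrN.
have mY i : measurable_fun setT (Y i) by exact: measurable_funN.
exists ([set w | t * Num.sqrt (\sum_(i < n) X i w ^+ 2) <= \sum_(i < n) X i w] `|`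
  [set w | t * Num.sqrt (\sum_(i < n) Y i w ^+ 2) <= \sum_(i < n) Y i w]).
  by apply: measurableU; exact: measurable_selfnorm.
split.
  apply: (le_trans (measureU2 _ _ _)); try exact: measurable_selfnorm.
  rewrite mulrDl mul1r EFinD; apply: leeD; first exact: JSW_upper_tail.
  have dY : dnd1 P Y delta = dnd1 P X delta := dnd1_opp P X delta.
  have indY : mutually_indep P (fun i => sigma_of [set Y i]).
    by apply: mutually_indep_sub indX => i; exact: sigma_of_opp.
  have meanY i : (\int[P]_w (Y i w)%:E = 0)%E.
    under eq_integral do rewrite /Y EFinN.
    rewrite integralN; first by rewrite (meanX i) oppe0.
    (* A difference of two equal infinities is infinite by convention, so a zero mean excludes that
       positive and negative parts both have infinite integral. *)
    have sub0 (a b : \bar R) : (a - b = 0 -> a +? - b)%E by case: a b => [a| |] [b| |].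
    by apply: sub0; rewrite -integralE; exact: meanX.
  have momY i : (\int[P]_w (`|Y i w| `^ (2 + delta)%R)%:E < +oo)%E.
    by under eq_integral do rewrite /Y normrN; exact: momX.
  have nzY i : (0 < P [set w | (Y i w != 0)%R])%E.
    by under eq_set do rewrite /Y oppr_eq0; exact: nzX.
  have tY : 0 <= t <= dnd1 P Y delta by rewrite dY.
  have := JSW_upper_tail JSW n0 delta01 mY indY meanY momY nzY tY.
  by rewrite dY.
move=> w /= /not_orP[/negP + /negP]; rewrite -!ltNge YX sumrN => h1 h2.
by rewrite ler_norml lerNl !ltW.
Qed.

Lemma union_bound {R : realType} {d : measure_display} {T : measurableType d}
  (P : probability T R) (L : nat) (B : 'I_L -> set T) (beta : R) :
  (forall l, measurable (B l)) -> (forall l, (P (B l) <= beta%:E)%E) ->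
  exists2 G, measurable G & ((1 - L%:R * beta)%:E <= P G)%E /\
    forall w, G w -> forall l, ~ B l w.
Proof.
move=> mB PB.
have [mU PU] : measurable (\big[setU/set0]_(l < L) B l) /\
    (P (\big[setU/set0]_(l < L) B l) <= (L%:R * beta)%:E)%E.
  have -> : L%:R * beta = \sum_(l < L) beta by rewrite sumr_const card_ord mulr_natl.
  apply: (big_rec2 (fun A x => measurable A /\ (P A <= x%:E)%E)).
    by rewrite measure0.
  move=> l x A _ [mA PA]; split; first exact: measurableU.
  apply: (le_trans (measureU2 _ (mB l) mA)).
  by rewrite EFinD; apply: leeD; first exact: PB.
exists (~` \big[setU/set0]_(l < L) B l); first exact: measurableC.
split; last by move=> w Gw l Bl; apply: Gw; rewrite (bigD1 l)//=; left.
by rewrite probability_setC// EFinB leeB.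
Qed.

Lemma probability_setI_ge {R : realType} {d : measure_display} {T : measurableType d}
  (P : probability T R) (A B : set T) (a b : R) :
  measurable A -> measurable B -> ((1 - a)%:E <= P A)%E -> ((1 - b)%:E <= P B)%E ->
  ((1 - (a + b))%:E <= P (A `&` B))%E.
Proof.
move=> mA mB PA PB; rewrite -[A `&` B]setCK probability_setC; last first.
  by apply: measurableC; exact: measurableI.
rewrite EFinB leeB// setCI.
apply: (le_trans (measureU2 _ _ _)); try exact: measurableC.
have compl C e : measurable C -> ((1 - e)%:E <= P C)%E -> (P (~` C) <= e%:E)%E.
  move=> mC PC; rewrite probability_setC// -(@fineK _ (P C)) ?fin_num_measure//.
  rewrite -(@fineK _ (P C)) ?fin_num_measure// lee_fin in PC.
  by rewrite -EFinB lee_fin; lra.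
by rewrite EFinD leeD// compl.
Qed.

(** * The failure probability [alpha] *)

Section Alpha.
Context {R : realType}.
Variables (L : nat) (A delta : R).
Hypotheses (L0 : (0 < L)%N) (A1 : 1 <= A).
Let t := A * Num.sqrt (2 * ln (L%:R : R)).

Let lnL0 : 0 <= ln (L%:R : R).
Proof. by rewrite ln_ge0// ler1n. Qed.

Let t0 : 0 <= t.
Proof. by rewrite /t mulr_ge0 ?sqrtr_ge0// (le_trans ler01). Qed.

Let t2 : t ^+ 2 = A ^+ 2 * (2 * ln (L%:R : R)).
Proof. by rewrite exprMn sqr_sqrtr// mulr_ge0. Qed.

(** After taking logarithms, the growth condition on [L] reads [t ^+ 2 <= dn ^+ 2]; it places [t] in
    the range of the moderate deviation bound. *)
Lemma threshold_le (dn : R) : 0 <= dn ->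
  L%:R <= expR (dn ^+ 2 / (2 * A ^+ 2)) -> t <= dn.
Proof.
move=> dn0 Ldn; have h : ln L%:R <= dn ^+ 2 / (2 * A ^+ 2).
  by rewrite -[leRHS]expRK ler_ln ?posrE ?ltr0n ?expR_gt0.
have A20 : 0 < 2 * A ^+ 2 by rewrite mulr_gt0// exprn_gt0// (lt_le_trans ltr01).
move: h; rewrite ler_pdivlMr// => h.
rewrite -(@ler_pXn2r _ 2)// ?nnegrE// t2; apply: le_trans h.
by lra.
Qed.

(* The Gaussian tail bound turns the relative error of the moderate deviation
   bound into the absolute error term of alpha. *)
Lemma union_bound_alpha (A0 dn : R) : 0 <= A0 -> 0 < dn -> 0 < delta ->
  L%:R * (2 * ((1 - Phi t) * (1 + A0 * ((1 + t) / dn) `^ (2 + delta)))) <=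
  2 * L%:R * (1 - Phi t) +
    2 * A0 * (1 + t) `^ (1 + delta) / (L%:R `^ (A ^+ 2 - 1) * dn `^ (2 + delta)).
Proof.
move=> A00 dn0 delta0.
have t1 : 0 < 1 + t by rewrite ltr_pwDl.
have L1 : 0 < L%:R :> R by rewrite ltr0n.
(* One factor [1 + t] is split off, to be absorbed by the Gaussian tail bound. *)
have -> : ((1 + t) / dn) `^ (2 + delta) = (1 + t) * (1 + t) `^ (1 + delta) / dn `^ (2 + delta).
  rewrite powRM ?invr_ge0 ?ltW// (_ : 2 + delta = 1 + (1 + delta)); last by ring.
  rewrite powRD; last by rewrite (gt_eqF t1) implybT.
  by rewrite powRr1 ?(ltW t1)// -powR_inv1 ?ltW// -powRrM mulN1r powRN.
have tail := Gaussian_tail t0.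
(* At this [t] the bound [expR (- (t ^+ 2 / 2))] is [L] to the power [- A ^+ 2]; the factor [L] of
   the union bound accounts for the [- 1] in the exponent. *)
have key : L%:R * ((1 + t) * (1 - Phi t)) <= (L%:R `^ (A ^+ 2 - 1))^-1.
  apply: (le_trans (ler_wpM2l (ltW L1) tail)).
  rewrite /powR (gt_eqF L1) -expRN -[X in X * _](@lnK _ L%:R)// -expRD ler_expR t2.
  by rewrite le_eqVlt; apply/orP; left; apply/eqP; field.
have D0 : 0 < dn `^ (2 + delta) by rewrite powR_gt0.
have W0 : 0 <= 2 * A0 * (1 + t) `^ (1 + delta) / dn `^ (2 + delta).
  by rewrite !mulr_ge0// ?invr_ge0 ?powR_ge0.
have := ler_wpM2r W0 key.
have P0 : 0 < (L%:R : R) `^ (A ^+ 2 - 1) by rewrite powR_gt0.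
move: (L%:R `^ _) (dn `^ _) ((1 + t) `^ _) P0 D0 {W0} => p q x p0 q0 h.
rewrite [leLHS](_ : _ = 2 * L%:R * (1 - Phi t) +
  L%:R * ((1 + t) * (1 - Phi t)) * (2 * A0 * x / q)); last by field; rewrite gt_eqF.
rewrite lerD2l (_ : 2 * A0 * x / (p * q) = p^-1 * (2 * A0 * x / q))//.
by field; rewrite !gt_eqF.
Qed.

End Alpha.

(** With [ln 1 = 0] the first term is [2 (1 - Phi 0) = 1], and the second is nonnegative. If
    [dn = 0], the second is 0 because the inverse of 0 is 0. *)
Lemma alpha1_ge1 {R : realType} (A0 delta A dn : R) : 0 <= dn -> (0 < dn -> 0 <= A0) ->
  0 < delta ->
  1 <= 2 * 1 * (1 - Phi (A * Num.sqrt (2 * ln 1))) +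
    2 * A0 * (1 + A * Num.sqrt (2 * ln 1)) `^ (1 + delta) /
    (1 `^ (A ^+ 2 - 1) * dn `^ (2 + delta)) :> R.
Proof.
move=> dn0 A00 delta0; rewrite ln1 mulr0 sqrtr0 mulr0 Phi0 addr0 !powR1.
rewrite (_ : 2 * 1 * _ = 1); last by field.
rewrite lerDl mulr1 mul1r; move: dn0; rewrite le_eqVlt => /predU1P[<-|dn0].
  rewrite powR0 ?invr0 ?mulr0//; lra.
by rewrite divr_ge0 ?powR_ge0// mulr_ge0// A00.
Qed.

Lemma score_event {R : realType} {d : measure_display} {T : measurableType d}
  (P : probability T R) (n L : nat) (X : 'I_L -> 'I_n -> T -> R) (A0 A delta dn : R) :
  JSW_constant A0 -> (0 < n)%N -> (0 < L)%N -> 0 < delta <= 1 -> 1 <= A ->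
  (forall l i, measurable_fun setT (X l i)) ->
  (forall l, mutually_indep P (fun i => sigma_of [set X l i])) ->
  (forall l i, (\int[P]_w (X l i w)%:E = 0)%E) ->
  (forall l i, (\int[P]_w (`|X l i w| `^ (2 + delta)%R)%:E < +oo)%E) ->
  (forall l i, (0 < P [set w | (X l i w != 0)%R])%E) ->
  0 < dn -> (forall l, dn <= dnd1 P (X l) delta) ->
  L%:R <= expR (dn ^+ 2 / (2 * A ^+ 2)) ->
  let t := A * Num.sqrt (2 * ln (L%:R : R)) in
  exists2 G, measurable G &
    ((1 - (2 * L%:R * (1 - Phi t) +
       2 * A0 * (1 + t) `^ (1 + delta) / (L%:R `^ (A ^+ 2 - 1) * dn `^ (2 + delta))))%R%:E
     <= P G)%E /\
    forall w, G w -> forall l,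
      `|\sum_(i < n) X l i w| <= t * Num.sqrt (\sum_(i < n) X l i w ^+ 2).
Proof.
move=> JSW n0 L0 delta01 A1 mX indX meanX momX nzX dn0 dnX Ldn t.
have /andP[delta0 _] := delta01.
have t0 : 0 <= t by rewrite mulr_ge0 ?sqrtr_ge0//; lra.
have tdn : t <= dn by apply: (threshold_le L0 A1 (ltW dn0)).
have tX l : 0 <= t <= dnd1 P (X l) delta by rewrite t0 (le_trans tdn).
have A00 : 0 <= A0.
  pose l := Ordinal L0.
  apply: (JSW_constant_ge0 JSW n0 delta01 (mX l) (indX l) (meanX l) (momX l) (nzX l) (tX l)).
  exact: lt_le_trans (dnX l).
have h l := selfnorm_two_sided JSW n0 delta01 (mX l) (indX l) (meanX l) (momX l) (nzX l) (tX l).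
have {h} [B hB] := choice (fun l => let: ex_intro2 B mB h := h l in ex_intro _ B (conj mB h)).
have [||G mG [PG hG]] := @union_bound _ _ _ P L B
  (2 * ((1 - Phi t) * (1 + A0 * ((1 + t) / dn) `^ (2 + delta)))).
- by move=> l; have [] := hB l.
(* The error term decreases in [dnd1], so the lower bound [dn] gives one bound valid for all [l]. *)
- move=> l; have [_ [PB _]] := hB l; apply: (le_trans PB); rewrite lee_fin.
  rewrite ler_pM2l// ler_pM2l ?Phi_lt1// lerD2l ler_wpM2l//.
  have d0 : 0 < dnd1 P (X l) delta by apply: lt_le_trans (dnX l).
  have t1 : 0 <= 1 + t by lra.
  apply: ge0_ler_powR; rewrite ?nnegrE; [lra|exact: divr_ge0 (ltW d0)|exact: divr_ge0 (ltW dn0)|].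
  by rewrite ler_wpM2l// lef_pV2.
exists G => //; split.
  apply: le_trans PG; rewrite lee_fin lerB//.
  exact: union_bound_alpha.
by move=> w Gw l; have [_ [_]] := hB l; apply; exact: hG.
Qed.

(** * Norms and sensitivities *)

(** Cauchy-Schwarz with norms replaced by upper bounds, obtained by summing
    [a b <= (q/p) a^2 / 2 + (p/q) b^2 / 2]. If [p] or [q] is 0, the corresponding vector
    vanishes. *)
Lemma sum_mul_le_sqr {R : realFieldType} {n : nat} (a b : 'I_n -> R) (p q : R) :
  0 <= p -> 0 <= q -> \sum_(i < n) a i ^+ 2 <= p ^+ 2 -> \sum_(i < n) b i ^+ 2 <= q ^+ 2 ->
  \sum_(i < n) a i * b i <= p * q.
Proof.
have sum0 (e : 'I_n -> R) : \sum_(i < n) e i ^+ 2 <= 0 -> forall i, e i = 0.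
  move=> e0 i; apply/eqP; rewrite -sqrf_eq0; apply/eqP.
  apply: (psumr_eq0P (P := xpredT) (F := fun i => e i ^+ 2)) => // [j _|]; first exact: sqr_ge0.
  by apply/le_anti; rewrite e0 sumr_ge0// => j _; exact: sqr_ge0.
rewrite le_eqVlt => /predU1P[<- _|p0].
  rewrite expr0n /= mul0r => /sum0 a0 _; rewrite big1// => i _.
  by rewrite a0 mul0r.
rewrite le_eqVlt => /predU1P[<- _|q0].
  rewrite expr0n /= mulr0 => /sum0 b0; rewrite big1// => i _.
  by rewrite b0 mulr0.
move=> ap bq.
have h i : a i * b i <= (q / p / 2) * a i ^+ 2 + (p / q / 2) * b i ^+ 2.
  rewrite -subr_ge0 (_ : _ - _ = (a i * q - b i * p) ^+ 2 / (2 * p * q)).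
    by rewrite divr_ge0 ?sqr_ge0// !mulr_ge0// ltW.
  by field; rewrite !gt_eqF.
apply: le_trans (ler_sum _ (fun i _ => h i)) _.
rewrite big_split /= -!mulr_sumr.
have -> : p * q = (q / p / 2) * p ^+ 2 + (p / q / 2) * q ^+ 2 by field; rewrite !gt_eqF.
by apply: lerD; rewrite ler_wpM2l// !mulr_ge0// ?invr_ge0 ltW.
Qed.

Lemma sgr_close {R : realDomainType} (a b : R) : `|a - b| < `|b| -> Num.sg a = Num.sg b.
Proof.
have [b0|b0|->] := ltrgt0P b; last by rewrite subr0 normr_lt0.
- by rewrite (gtr0_sg b0) => h; rewrite gtr0_sg//; move: h; rewrite ltr_norml => /andP[]; lra.
- by rewrite (ltr0_sg b0) => h; rewrite ltr0_sg//; move: h; rewrite ltr_norml => /andP[]; lra.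
Qed.

Section Norms.
Context {R : realType}.

Lemma colmax_ge {n K : nat} (X : 'I_n -> 'I_K -> R) i k : `|X i k| <= colmax X k.
Proof. exact: (le_bigmax _ (fun i => `|X i k|)). Qed.

Lemma colmax_ge0 {n K : nat} (X : 'I_n -> 'I_K -> R) k : 0 <= colmax X k.
Proof. exact: bigmax_ge_id. Qed.

Lemma colmax_eq0 {n K : nat} (X : 'I_n -> 'I_K -> R) k :
  colmax X k = 0 -> forall i, X i k = 0.
Proof.
by move=> X0 i; apply/eqP; rewrite -normr_le0 -X0 colmax_ge.
Qed.

(** The rescaling is harmless even for a zero column, where the inverse is 0 but the entries vanish
    too. *)
Lemma colmaxK {n K : nat} (X : 'I_n -> 'I_K -> R) i k :
  X i k * (colmax X k)^-1 * colmax X k = X i k.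
Proof.
have [X0|X0] := eqVneq (colmax X k) 0; last by rewrite mulfVK.
by rewrite (colmax_eq0 X0) !mul0r.
Qed.

Lemma linfnorm_ge {L : nat} (v : 'I_L -> R) l : `|v l| <= linfnorm v.
Proof. exact: (le_bigmax _ (fun l => `|v l|)). Qed.

Lemma linfnorm_ge0 {L : nat} (v : 'I_L -> R) : 0 <= linfnorm v.
Proof. exact: bigmax_ge_id. Qed.

Lemma linfnorm_le {L : nat} (v : 'I_L -> R) (b : R) :
  0 <= b -> (forall l, `|v l| <= b) -> linfnorm v <= b.
Proof. by move=> b0 h; apply: bigmax_le. Qed.

Lemma l1norm_ge0 {K : nat} (J : {set 'I_K}) (D : 'I_K -> R) : 0 <= l1norm J D.
Proof. exact: sumr_ge0. Qed.

Lemma l1norm_set1 {K : nat} (k : 'I_K) (D : 'I_K -> R) : l1norm [set k]%SET D = `|D k|.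
Proof. exact: big_set1. Qed.

Lemma l1norm_set0 {K : nat} (D : 'I_K -> R) : l1norm finset.set0 D = 0.
Proof. exact: big_set0. Qed.

Lemma sum_setC {K : nat} (J : {set 'I_K}) (f : 'I_K -> R) :
  \sum_(k < K) f k = \sum_(k in J) f k + \sum_(k in ~: J) f k.
Proof.
rewrite (bigID (mem J)) /=; congr +%R.
by apply: eq_bigl => k; rewrite inE.
Qed.

Lemma l1norm_setT {K : nat} (J : {set 'I_K}) (D : 'I_K -> R) :
  l1norm [set: 'I_K]%SET D = l1norm J D + l1norm (~: J) D.
Proof.
rewrite /l1norm -sum_setC; apply: eq_bigl => k.
by rewrite inE.
Qed.

Lemma l1normZ {K : nat} (J : {set 'I_K}) (a : R) (D : 'I_K -> R) :
  l1norm J (fun k => a * D k) = `|a| * l1norm J D.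
Proof. by rewrite /l1norm mulr_sumr; apply: eq_bigr => k _; rewrite normrM. Qed.

Lemma linfnorm_mulmvZ {L K : nat} (M : 'I_L -> 'I_K -> R) (a : R) (D : 'I_K -> R) :
  linfnorm (mulmv M (fun k => a * D k)) <= `|a| * linfnorm (mulmv M D).
Proof.
apply: linfnorm_le => [|l]; first by rewrite mulr_ge0 ?linfnorm_ge0.
rewrite (_ : mulmv M _ l = a * mulmv M D l); last first.
  by rewrite /mulmv mulr_sumr; apply: eq_bigr => k _; rewrite mulrCA.
by rewrite normrM ler_wpM2l// linfnorm_ge.
Qed.

End Norms.

(** * Sensitivities as homogeneous lower bounds *)

Section Sensitivities.
Context {R : realType}.
Variables (L K : nat) (Psi : 'I_L -> 'I_K -> R) (c : R).

(** Normalization: [S] is stable under positive scaling, and a vector with nonzero norm on [J0] is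
    rescaled into the set [S'] over which the infimum runs. *)
Let inf_lb (S S' : set ('I_K -> R)) (J0 : {set 'I_K}) (rho : R) (D : 'I_K -> R) :
  (forall a E, 0 < a -> S E -> S (fun k => a * E k)) ->
  (forall E, S E -> l1norm J0 E = 1 -> S' E) ->
  (rho%:E <= ereal_inf [set (linfnorm (mulmv Psi D))%:E | D in S'])%E ->
  S D -> rho * l1norm J0 D <= linfnorm (mulmv Psi D).
Proof.
move=> Sh SS' rhole SD; have := l1norm_ge0 J0 D.
rewrite le_eqVlt => /predU1P[<-|N0]; first by rewrite mulr0 linfnorm_ge0.
set N := l1norm J0 D in N0 *.
have N1 : 0 < N^-1 by rewrite invr_gt0.
have : (rho%:E <= (linfnorm (mulmv Psi (fun k => N^-1 * D k)))%:E)%E.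
  apply: (le_trans rhole); apply: ereal_inf_lbound.
  exists (fun k => N^-1 * D k) => //; apply: SS'; first exact: Sh.
  by rewrite l1normZ gtr0_norm// mulVf// gt_eqF.
rewrite lee_fin => /le_trans/(_ (linfnorm_mulmvZ _ _ _)).
by rewrite gtr0_norm// mulrC ler_pdivlMr.
Qed.

Lemma kappaJJ_lb (J : {set 'I_K}) (rho : R) (D : 'I_K -> R) :
  (rho%:E <= kappaJJ Psi c J J)%E -> coneC c J D ->
  rho * l1norm J D <= linfnorm (mulmv Psi D).
Proof.
rewrite /kappaJJ; case: eqP => [->|_]; first by rewrite l1norm_set0 mulr0 linfnorm_ge0.
apply: inf_lb => [a E a0|E]; last by [].
by rewrite /coneC /= !l1normZ gtr0_norm// mulrCA ler_pM2l.
Qed.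

Lemma kappas_lb (s : nat) (J0 : {set 'I_K}) (rho : R) (j : 'I_K) (D : 'I_K -> R) :
  (rho%:E <= kappas Psi c s J0)%E ->
  l1norm [set: 'I_K]%SET D <= 2 * s%:R / (1 - c) * `|D j| ->
  rho * l1norm J0 D <= linfnorm (mulmv Psi D).
Proof.
rewrite /kappas; case: eqP => [->|_]; first by rewrite l1norm_set0 mulr0 linfnorm_ge0.
move=> h; apply: (inf_lb (S := [set D | l1norm [set: 'I_K]%SET D <= 2 * s%:R / (1 - c) * `|D j|])).
- by move=> a E a0 /=; rewrite l1normZ normrM gtr0_norm// mulrCA ler_pM2l.
- by move=> E SE NE; exact: (conj NE SE).
- exact: (le_trans h (bigmin_le _ j _)).
Qed.

(** The indicator vector of [k] is admissible, since [2 s / (1 - c) >= 1]. Hence the denominator of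
    the threshold is a real number. *)
Lemma kappas_set1_lty (s : nat) (k : 'I_K) :
  (1 <= s)%N -> 0 < c < 1 -> (kappas Psi c s [set k]%SET < +oo)%E.
Proof.
move=> s1 /andP[c0 c1]; rewrite /kappas; case: eqP => [/setP/(_ k)|_].
  by rewrite !inE eqxx.
apply: (le_lt_trans (bigmin_le _ k _)) => //.
pose D (j : 'I_K) : R := (j == k)%:R.
apply: (@le_lt_trans _ _ (linfnorm (mulmv Psi D))%:E); last exact: ltry.
apply: ereal_inf_lbound; exists D => //; split.
  by rewrite l1norm_set1 /D eqxx normr1.
rewrite (l1norm_setT [set k]%SET) l1norm_set1 /D eqxx normr1 mulr1.
rewrite /l1norm big1 ?addr0; last by move=> j; rewrite !inE => /negbTE ->; rewrite normr0.
rewrite ler_pdivlMr; last lra.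
have : (1 : R) <= s%:R by rewrite (ler_nat _ 1).
by lra.
Qed.

(** A single real [e] covers both finite and infinite sensitivity; in the infinite case [e = 0], and
    the norm on [J0] has to vanish. *)
Lemma einv_kappas (s : nat) (J0 : {set 'I_K}) (c0 : R) :
  0 < c0 -> (c0%:E <= kappas Psi c s J0)%E ->
  exists e : R, [/\ einv (kappas Psi c s J0) = e%:E, 0 <= e <= c0^-1 &
    forall D j, l1norm [set: 'I_K]%SET D <= 2 * s%:R / (1 - c) * `|D j| ->
      l1norm J0 D <= e * linfnorm (mulmv Psi D)].
Proof.
move=> c00; case E: (kappas Psi c s J0) => [rho| |]//.
  rewrite lee_fin => c0rho; have rho0 := lt_le_trans c00 c0rho.
  exists rho^-1; split; first by rewrite /= rho0.
    by rewrite invr_ge0 ltW//= lef_pV2.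
  move=> D j Dj; rewrite ler_pdivlMl//; apply: (kappas_lb (s := s) (j := j)) => //.
  by rewrite E.
move=> _; exists 0; split => //; first by rewrite lexx invr_ge0 ltW.
move=> D j Dj; rewrite mul0r leNgt; apply/negP => N0.
(* An infinite sensitivity admits every lower bound; this one would make the norm of [Psi D] exceed
   itself by 1. *)
have := @kappas_lb s J0 ((linfnorm (mulmv Psi D) + 1) / l1norm J0 D) j D.
rewrite E leey => /(_ isT Dj).
by rewrite divfK ?gt_eqF// leNgt ltrDl ltr01.
Qed.

End Sensitivities.

(** * STIV error bounds *)

Section Oracle.
Context {R : realType}.
Variables (n K L kend : nat) (Y u : 'I_n -> R) (X : 'I_n -> 'I_K -> R)
  (Z : 'I_n -> 'I_L -> R) (b : 'I_K -> R) (c r q : R) (bh : 'I_K -> R) (sh : R).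
Hypotheses (n0 : (0 < n)%N) (KL : (K <= L)%N).
Hypothesis YE : forall i, Y i = \sum_(k < K) X i k * b k + u i.
Hypothesis ZX : forall (l : 'I_L) (k : 'I_K),
  nat_of_ord k = (kend + nat_of_ord l)%N -> forall i, Z i l = X i k.
Hypotheses (c01 : 0 < c < 1) (r0 : 0 <= r) (q0 : 0 <= q).
Hypothesis qE : n%:R^-1 * \sum_(i < n) u i ^+ 2 = q ^+ 2.
Hypothesis score : forall l, `|n%:R^-1 * \sum_(i < n) Z i l * u i|
  <= r * Num.sqrt (n%:R^-1 * \sum_(i < n) (Z i l * u i) ^+ 2).
Hypothesis stiv : is_STIV c r Y X Z bh sh.

Local Notation J := (supp b).
Local Notation Jend := [set j : 'I_K | (j < kend)%N]%SET.
Local Notation D := (fun k => colmax X k * (bh k - b k)).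
Local Notation Psi := (PsiN X Z).
Local Notation ninv := (n%:R^-1 : R).

Let ninv0 : 0 < ninv. Proof. by rewrite invr_gt0 ltr0n. Qed.

(** A limit [sg -> q]: feasibility demands [sg > 0] while [q] may be 0, so the true vector is only
    compared at [sg > q]. *)
Let shift_bound (x y : R) :
  (forall sg, q < sg -> x <= y + c * sg) -> x <= y + c * q.
Proof.
move=> h; apply/ler_addgt0Pr => e e0; rewrite -addrA.
have /andP[c0 _] := c01.
rewrite (_ : _ + e = c * (q + e / c)); last by field; rewrite gt_eqF.
by apply: h; rewrite ltrDl divr_gt0.
Qed.

Let score_colmax l : `|n%:R^-1 * \sum_(i < n) Z i l * u i| <= r * (colmax Z l * q).
Proof.
apply: (le_trans (score l)); rewrite ler_wpM2l//.
rewrite -[leRHS]ger0_norm ?mulr_ge0 ?colmax_ge0// -sqrtr_sqr ler_wsqrtr//.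
rewrite exprMn -qE mulrCA (ler_wpM2l (ltW ninv0))// mulr_sumr ler_sum// => i _.
rewrite exprMn ler_wpM2r ?sqr_ge0// -[Z i l ^+ 2]real_normK ?num_real//.
by rewrite lerXn2r ?nnegrE ?colmax_ge0 ?colmax_ge.
Qed.

Let resid_b : resid Y X b =1 u.
Proof. by move=> i; rewrite /resid YE addrC addKr. Qed.

Let resid_bh i : resid Y X bh i = u i - \sum_(k < K) X i k * (bh k - b k).
Proof.
under [in RHS]eq_bigr do rewrite mulrBr.
by rewrite /resid YE sumrB; ring.
Qed.

Let score_norm l :
  `|n%:R^-1 * (colmax Z l)^-1 * \sum_(i < n) Z i l * u i| <= r * q.
Proof.
have [Zl|Zl] := eqVneq (colmax Z l) 0.
  by rewrite Zl invr0 mulr0 mul0r normr0 mulr_ge0.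
have Zl0 : 0 < colmax Z l by rewrite lt_def Zl colmax_ge0.
rewrite mulrAC -mulrC normrM gtr0_norm ?invr_gt0//.
by rewrite ler_pdivrMl// mulrCA.
Qed.

Let feasible_b sg : q < sg -> STIV_feasible r Y X Z b sg.
Proof.
move=> qsg; have sg0 : 0 < sg by exact: le_lt_trans qsg.
split => //.
- apply: linfnorm_le => [|l]; first by rewrite mulr_ge0// ltW.
  under eq_bigr do rewrite resid_b.
  by apply: (le_trans (score_norm l)); rewrite mulrC ler_wpM2r// ltW.
- rewrite /Qhat; under eq_bigr do rewrite resid_b.
  by rewrite qE lerXn2r ?nnegrE// ltW.
Qed.

Lemma STIV_sigma_gt0 : 0 < sh.
Proof. by have [[]] := stiv. Qed.

Let sh0 := STIV_sigma_gt0.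

Lemma STIV_obj_le : STIV_obj c X bh sh <= \sum_(k < K) colmax X k * `|b k| + c * q.
Proof.
apply: shift_bound => sg qsg.
by have [_] := stiv; apply; exact: feasible_b.
Qed.

(** The objective comparison is split along the support: off [J] the true vector is 0 and the
    penalty of [bh] is exactly that of the error; on [J] the triangle inequality applies. *)
Lemma STIV_l1norm : l1norm (~: J) D + c * sh <= l1norm J D + c * q.
Proof.
have := STIV_obj_le; rewrite /STIV_obj !(sum_setC J).
have -> : \sum_(k in ~: J) colmax X k * `|b k| = 0.
  by apply: big1 => k; rewrite !inE negbK => /eqP ->; rewrite normr0 mulr0.
have -> : \sum_(k in ~: J) colmax X k * `|bh k| = l1norm (~: J) D.
  apply: eq_bigr => k; rewrite !inE negbK => /eqP ->.
  by rewrite subr0 normrM ger0_norm// colmax_ge0.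
have : \sum_(k in J) colmax X k * `|b k| <= \sum_(k in J) colmax X k * `|bh k| + l1norm J D.
  rewrite /l1norm -big_split; apply: ler_sum => k _ /=.
  rewrite normrM ger0_norm ?colmax_ge0// -mulrDr ler_wpM2l ?colmax_ge0//.
  by rewrite -lerBlDl distrC; exact: lerB_dist.
lra.
Qed.

(** [Psi D] is the normalized score at the true vector minus that at [bh]. The score event bounds
    the first by [r q], feasibility the second by [r sh]. *)
Lemma linfnorm_PsiD : linfnorm (mulmv Psi D) <= r * (sh + q).
Proof.
apply: linfnorm_le => [|l]; first by rewrite mulr_ge0// addr_ge0// ltW.
have -> : mulmv Psi D l = n%:R^-1 * (colmax Z l)^-1 * \sum_(i < n) Z i l * u i
    - n%:R^-1 * (colmax Z l)^-1 * \sum_(i < n) Z i l * resid Y X bh i.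
  rewrite -mulrBr -sumrB /mulmv /PsiN.
  under [in RHS]eq_bigr do rewrite -mulrBr resid_bh subKr mulr_sumr.
  rewrite exchange_big /= mulr_sumr; apply: eq_bigr => k _.
  rewrite -!mulrA; congr (_ * _); rewrite mulr_suml mulr_sumr; apply: eq_bigr => i _.
  by rewrite -[in RHS](colmaxK X i k); ring.
apply: (le_trans (ler_normB _ _)); rewrite mulrDr addrC lerD//.
have [[_ + _] _] := stiv; rewrite mulrC; apply: le_trans.
exact: (linfnorm_ge (fun l => n%:R^-1 * (colmax Z l)^-1 * \sum_(i < n) Z i l * resid Y X bh i)).
Qed.

(* Convexity of the root mean square: its decrease from b to bh is at most the
   slope at b, whose coordinates are the normalized scores. *)
Let rms_slope (m : 'I_K -> R) : (forall k, 0 <= m k) ->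
  (forall k, `|n%:R^-1 * \sum_(i < n) X i k * u i| <= m k * (colmax X k * q)) ->
  q - sh <= \sum_(k < K) m k * `|D k|.
Proof.
move=> m0 hm.
have S0 : 0 <= \sum_(k < K) m k * `|D k| by apply: sumr_ge0 => k _; rewrite mulr_ge0.
(* The argument multiplies through by [q], so [q = 0] is treated apart; there the left side is
   negative. *)
move: (q0); rewrite le_eqVlt => /predU1P[q0'|q1].
  by apply: le_trans S0; rewrite -q0' sub0r oppr_le0 ltW.
rewrite -(ler_pM2l q1) mulrBr.
have n1 : 0 <= Num.sqrt (n%:R : R) by exact: sqrtr_ge0.
have nn : Num.sqrt (n%:R : R) ^+ 2 = n%:R by rewrite sqr_sqrtr// ler0n.
have nneq : n%:R != 0 :> R by rewrite pnatr_eq0 -lt0n.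
(* Cauchy-Schwarz, with the feasibility constraint [Qhat <= sh ^+ 2] on the fitted residuals. *)
have CS : n%:R^-1 * \sum_(i < n) u i * resid Y X bh i <= q * sh.
  rewrite -(ler_pM2l (_ : 0 < n%:R :> R)) ?ltr0n// mulVKf//.
  apply: (le_trans (@sum_mul_le_sqr _ _ _ _ (Num.sqrt n%:R * q) (Num.sqrt n%:R * sh) _ _ _ _)).
  - by rewrite mulr_ge0.
  - by rewrite mulr_ge0// ltW.
  - by rewrite exprMn nn -qE mulVKf.
  - by rewrite exprMn nn -ler_pdivrMl ?ltr0n//; have [[]] := stiv.
  - by rewrite mulrACA -expr2 nn.
have sl : n%:R^-1 * \sum_(i < n) u i * \sum_(k < K) X i k * (bh k - b k)
    <= q * \sum_(k < K) m k * `|D k|.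
  under eq_bigr do rewrite mulr_sumr.
  rewrite exchange_big /= !mulr_sumr ler_sum// => k _.
  have -> : n%:R^-1 * (\sum_(i < n) u i * (X i k * (bh k - b k)))
      = (n%:R^-1 * \sum_(i < n) X i k * u i) * (bh k - b k).
    by rewrite -mulrA mulr_suml; congr (_ * _); apply: eq_bigr => i _; ring.
  apply: (le_trans (ler_norm _)); rewrite normrM.
  apply: (le_trans (ler_wpM2r (normr_ge0 _) (hm k))).
  by rewrite normrM (ger0_norm (colmax_ge0 X k)); lra.
(* Pairing [u] with itself and writing one copy as fitted residual plus fitted error gives
   [q^2 <= q sh + q S], where [S] is the weighted sum. *)
have : q ^+ 2 = n%:R^-1 * \sum_(i < n) u i * resid Y X bh i +
   n%:R^-1 * \sum_(i < n) u i * \sum_(k < K) X i k * (bh k - b k).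
  rewrite -qE -mulrDr -big_split; congr (_ * _); apply: eq_bigr => i _ /=.
  by rewrite resid_bh; ring.
rewrite expr2; lra.
Qed.

(** Pure Cauchy-Schwarz, hence valid for endogenous regressors as well. The auxiliary [h] takes any
    [f] with the same absolute values, which yields both signs. *)
Let score_X k : `|n%:R^-1 * \sum_(i < n) X i k * u i| <= colmax X k * q.
Proof.
have nneq : n%:R != 0 :> R by rewrite pnatr_eq0 -lt0n.
have nn : Num.sqrt (n%:R : R) ^+ 2 = n%:R by rewrite sqr_sqrtr// ler0n.
have h (f : 'I_n -> R) : (forall i, `|f i| = `|X i k|) ->
    n%:R^-1 * \sum_(i < n) f i * u i <= colmax X k * q.
  move=> fX; rewrite -(ler_pM2l (_ : 0 < n%:R :> R)) ?ltr0n// mulVKf//.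
  apply: (le_trans (@sum_mul_le_sqr _ _ _ _ (Num.sqrt n%:R * colmax X k) (Num.sqrt n%:R * q) _ _ _ _)).
  - by rewrite mulr_ge0// ?sqrtr_ge0// colmax_ge0.
  - by rewrite mulr_ge0// sqrtr_ge0.
  - rewrite exprMn nn; apply: (@le_trans _ _ (\sum_(i < n) colmax X k ^+ 2)).
      apply: ler_sum => i _; rewrite -[f i ^+ 2]real_normK ?num_real// fX.
      by rewrite lerXn2r ?nnegrE ?colmax_ge0 ?colmax_ge.
    by rewrite sumr_const card_ord mulr_natl.
  - by rewrite exprMn nn -qE mulVKf.
  - by rewrite mulrACA -expr2 nn.
rewrite ler_norml h// andbT lerNl -mulrN -sumrN.
under eq_bigr do rewrite -mulNr.
by apply: h => i; rewrite normrN.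
Qed.

Lemma rms_gap_l1norm : q - sh <= l1norm [set: 'I_K]%SET D.
Proof.
apply: le_trans (rms_slope (m := fun=> 1) _ _) _ => // [k|].
  by rewrite mul1r; exact: score_X.
rewrite /l1norm le_eqVlt; apply/orP; left; apply/eqP.
by apply: eq_big => [k|k _]; rewrite ?inE ?mul1r.
Qed.

(** Exogenous regressors are their own instruments, so the score event improves their slope from 1
    to [r]. *)
Lemma rms_gap : q - sh <= l1norm Jend D + r * l1norm (~: Jend) D.
Proof.
pose m (k : 'I_K) : R := if k \in Jend then 1 else r.
apply: le_trans (rms_slope (m := m) _ _) _ => // [k|k|].
- by rewrite /m; case: ifP.
- rewrite /m; case: ifPn => [_|]; first by rewrite mul1r; exact: score_X.
  rewrite inE -leqNgt => kk.
  (* Regressor [k] is instrument number [k - kend], a valid index because [K <= L]. *)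
  have lL : (k - kend < L)%N by apply: leq_ltn_trans (leq_subr _ _) (leq_trans (ltn_ord k) KL).
  have zx := @ZX (Ordinal lL) k; have {}zx i : Z i (Ordinal lL) = X i k.
    by apply: zx; rewrite /= subnKC.
  have <- : colmax Z (Ordinal lL) = colmax X k by apply: eq_bigr => i _; rewrite zx.
  under eq_bigr do rewrite -zx.
  exact: score_colmax.
- rewrite (sum_setC Jend) mulr_sumr lerD//; apply: ler_sum => k; rewrite /m.
    by move=> ->; rewrite mul1r.
  by rewrite inE => /negbTE ->.
Qed.

(** Inserting [c (q - sh) <= c |D|_1] in the objective comparison moves a fraction [c] of the norm
    across: [(1 - c) |D_{J^c}|_1 <= (1 + c) |D_J|_1]. *)
Lemma STIV_cone : coneC c J D.
Proof.
have /andP[c0 c1] := c01.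
rewrite /coneC /= mulrAC ler_pdivlMr; last lra.
have := rms_gap_l1norm; rewrite (l1norm_setT J) => h.
have := STIV_l1norm; have := ler_wpM2l (ltW c0) h.
lra.
Qed.

(** The index [j] maximizes [|D j|]: the cone gives [|D|_1 <= 2 |D_J|_1 / (1 - c)], and [|D_J|_1] is
    at most [s] times the maximum. The index [k0] witnesses that there is a coordinate. *)
Lemma STIV_dominant (s : nat) (k0 : 'I_K) : (#|J| <= s)%N ->
  exists j, l1norm [set: 'I_K]%SET D <= 2 * s%:R / (1 - c) * `|D j|.
Proof.
move=> Js; have /andP[c0 c1] := c01.
exists [arg max_(i > k0) `|D i|]%O; case: arg_maxP => // j _ jmax.
have hJ : l1norm J D <= s%:R * `|D j|.
  apply: (@le_trans _ _ (\sum_(k in J) `|D j|)); first by apply: ler_sum => k _; exact: jmax.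
  by rewrite sumr_const -[leLHS]mulr_natl ler_wpM2r// ler_nat.
have := STIV_cone; rewrite /coneC /= mulrAC ler_pdivlMr; last lra.
rewrite (l1norm_setT J) mulrAC ler_pdivlMr; last lra.
by lra.
Qed.

(** This rearranges [c (sh - q) <= |D_J|_1 <= r (sh + q) / cJ]. *)
Lemma STIV_sigma_le (cJ : R) : 0 < cJ -> (cJ%:E <= kappaJJ Psi c J J)%E ->
  sh * (1 - r / (c * cJ)) <= q * (1 + r / (c * cJ)).
Proof.
move=> cJ0 /kappaJJ_lb/(_ STIV_cone) h.
have /andP[c0 c1] := c01.
have := le_trans h linfnorm_PsiD; have := STIV_l1norm.
have := l1norm_ge0 (~: J) D => Jc h1 h2.
rewrite -(ler_pM2l (mulr_gt0 c0 cJ0)).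
rewrite (_ : c * cJ * (sh * _) = c * cJ * sh - r * sh); last by field; rewrite !gt_eqF.
rewrite (_ : c * cJ * (q * _) = c * cJ * q + r * q); last by field; rewrite !gt_eqF.
have : cJ * (c * sh) <= cJ * (l1norm J D + c * q) by rewrite ler_pM2l//; lra.
by lra.
Qed.

(** With [p] the norm of [Psi D], the gap bound gives [q <= sh + e1 p + r e2 p]; substituted in
    [p <= r (sh + q)], it leaves an inequality in [p] and [sh] alone. No division is made, as the
    factor may be nonpositive. *)
Lemma linfnorm_PsiD_theta (e1 e2 : R) :
  l1norm Jend D <= e1 * linfnorm (mulmv Psi D) ->
  l1norm (~: Jend) D <= e2 * linfnorm (mulmv Psi D) ->
  linfnorm (mulmv Psi D) * (1 - r * e1 - r ^+ 2 * e2) <= 2 * sh * r.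
Proof.
move=> h1 h2; have := linfnorm_PsiD; have := rms_gap.
move: (linfnorm _) h1 h2 => p h1 h2 h3 h4.
have h5 : q <= sh + e1 * p + r * (e2 * p).
  have := ler_wpM2l r0 h2; lra.
have := ler_wpM2l r0 h5; rewrite expr2; lra.
Qed.

End Oracle.

(** * Sign recovery *)

Lemma einv_gt0 {R : realType} (a : R) : 0 < a -> einv a%:E = (a^-1)%:E.
Proof. by move=> a0; rewrite /einv a0. Qed.

Lemma einv_le0 {R : realType} (a : R) : a <= 0 -> einv a%:E = +oo%E.
Proof. by move=> a0; rewrite /einv ltNge a0. Qed.

Section SignRecovery.
Context {R : realType}.
Variables (n K L kend : nat) (Y u : 'I_n -> R) (X : 'I_n -> 'I_K -> R)
  (Z : 'I_n -> 'I_L -> R) (b : 'I_K -> R) (c r q : R) (bh : 'I_K -> R) (sh : R).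
Hypotheses (n0 : (0 < n)%N) (KL : (K <= L)%N).
Hypothesis YE : forall i, Y i = \sum_(k < K) X i k * b k + u i.
Hypothesis ZX : forall (l : 'I_L) (k : 'I_K),
  nat_of_ord k = (kend + nat_of_ord l)%N -> forall i, Z i l = X i k.
Hypotheses (c01 : 0 < c < 1) (r0 : 0 < r) (q0 : 0 <= q).
Hypothesis qE : n%:R^-1 * \sum_(i < n) u i ^+ 2 = q ^+ 2.
Hypothesis score : forall l, `|n%:R^-1 * \sum_(i < n) Z i l * u i|
  <= r * Num.sqrt (n%:R^-1 * \sum_(i < n) (Z i l * u i) ^+ 2).
Hypothesis stiv : is_STIV c r Y X Z bh sh.

Variables (s : nat) (sig cJ cend cendc : R) (v ck : 'I_K -> R).
Local Notation J := (supp b).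
Local Notation Jend := [set j : 'I_K | (j < kend)%N]%SET.
Local Notation Psi := (PsiN X Z).
Hypotheses (s1 : (1 <= s)%N) (Js : (#|J| <= s)%N) (sig0 : 0 < sig) (qsig : q <= sig).
Hypotheses (cJ0 : 0 < cJ) (cend0 : 0 < cend) (cendc0 : 0 < cendc).
Hypotheses (v0 : forall k, 0 < v k) (ck0 : forall k, 0 < ck k).
Hypothesis vX : forall k, k \in J -> v k <= colmax X k.
Hypothesis kJ : (cJ%:E <= kappaJJ Psi c J J)%E.
Hypothesis kk : forall k, ((ck k)%:E <= kappas Psi c s [set k]%SET)%E.
Hypothesis kend_lb : (cend%:E <= kappas Psi c s Jend)%E.
Hypothesis kendc_lb : (cendc%:E <= kappas Psi c s (~: Jend))%E.

Let sh0 : 0 < sh. Proof. by have [[]] := stiv. Qed.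

(** The random threshold is reduced to two reals, each bounded below by its deterministic
    counterpart. The error bound stays in product form so that it survives [theta <= 0] and a zero
    column. *)
Let omega_facts k : exists theta kap : R,
  [/\ 1 - r / cend - r ^+ 2 / cendc <= theta, ck k <= kap,
      omega_thr c r s kend X Z sh k =
        ((2 * sh * r)%:E * einv (kap * colmax X k)%:E * einv theta%:E)%E &
      (`|bh k - b k| * (kap * colmax X k)) * theta <= 2 * sh * r].
Proof.
have [e1 [E1 /andP[e10 e1c] h1]] := einv_kappas cend0 kend_lb.
have [e2 [E2 /andP[e20 e2c] h2]] := einv_kappas cendc0 kendc_lb.
have [j Dj] := STIV_dominant n0 YE c01 (ltW r0) q0 qE score stiv k Js.
have := kappas_set1_lty Psi k s1 c01.
have := kk k; case E: (kappas Psi c s [set k]%SET) => [kap| |]// ckkap _.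
rewrite lee_fin in ckkap.
exists (1 - r * e1 - r ^+ 2 * e2), kap; split => //.
- have := ler_wpM2l (ltW r0) e1c; have := ler_wpM2l (sqr_ge0 r) e2c; lra.
- by rewrite /omega_thr E E1 E2 -!EFinM.
- have hP := linfnorm_PsiD_theta n0 KL YE ZX (ltW r0) q0 qE score stiv (h1 _ _ Dj) (h2 _ _ Dj).
  have := @kappas_lb _ _ _ Psi c s [set k]%SET kap j _ _ Dj.
  rewrite E lexx l1norm_set1 normrM (ger0_norm (colmax_ge0 X k)) => /(_ isT) hk.
  set theta := 1 - _ - _ in hP *.
  have [theta0|theta0] := leP theta 0.
    apply: (@le_trans _ _ 0); last by rewrite !mulr_ge0// ltW.
    rewrite mulr_ge0_le0// !mulr_ge0 ?colmax_ge0//.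
    by rewrite (le_trans _ ckkap)// ltW.
  apply: le_trans hP; rewrite ler_pM2r//; apply: le_trans hk.
  by lra.
Qed.

(** A zero column or [theta <= 0] makes the threshold [+oo]; otherwise the product bound is divided
    through. *)
Lemma dist_le_omega k : (`|bh k - b k|%:E <= omega_thr c r s kend X Z sh k)%E.
Proof.
have [theta [kap [_ ckkap -> hb]]] := omega_facts k.
have kap0 : 0 < kap by apply: lt_le_trans ckkap.
have a0 : 0 < 2 * sh * r by rewrite !mulr_gt0.
have [Xk|Xk] := eqVneq (colmax X k) 0.
  rewrite Xk mulr0 (@einv_le0 _ 0)// gt0_muley ?lte_fin//.
  have [t0|t0] := leP theta 0; first by rewrite einv_le0// leey.
  by rewrite einv_gt0// gt0_mulye ?leey// lte_fin invr_gt0.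
have kX : 0 < kap * colmax X k by rewrite mulr_gt0// lt_def Xk colmax_ge0.
rewrite (einv_gt0 kX) -EFinM.
have [t0|t0] := leP theta 0.
  by rewrite einv_le0// gt0_muley ?leey// lte_fin mulr_gt0// invr_gt0.
by rewrite einv_gt0// -EFinM lee_fin ler_pdivlMr// ler_pdivlMr// mulrAC.
Qed.

Hypothesis beta_min : forall k, k \in J ->
  ((4 * sig * r)%:E * tau_star c r cJ cend cendc * einv (ck k * v k)%:E < (`|b k|)%:E)%E.

Lemma omega_lt_half k : k \in J ->
  exists2 W : R, (omega_thr c r s kend X Z sh k <= W%:E)%E & 2 * W < `|b k|.
Proof.
move=> kinJ; have := beta_min kinJ.
have [theta [kap [htheta ckkap -> _]]] := omega_facts k.
have /andP[c0 _] := c01.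
have hs := STIV_sigma_le n0 YE c01 (ltW r0) q0 qE score stiv cJ0 kJ.
have := vX kinJ; have := v0 k; have := ck0 k.
rewrite /tau_star; set rho := r / (c * cJ) in hs *.
set t := 1 - r / cend - r ^+ 2 / cendc in htheta *.
have rho0 : 0 < rho by rewrite divr_gt0// mulr_gt0.
move: (ck k) (v k) (colmax X k) (`|b k|) ckkap => ckk vk Xk bk ckkap ck1 vk1 vX1.
have kap0 : 0 < kap by apply: lt_le_trans ckkap.
have Xk0 : 0 < Xk by apply: lt_le_trans vX1.
have a0 : 0 < 4 * sig * r by rewrite !mulr_gt0.
have w0 : 0 < (ckk * vk)^-1 by rewrite invr_gt0 mulr_gt0.
rewrite (@einv_gt0 _ (ckk * vk)) ?mulr_gt0//.
(* When [t <= 0] or [rho >= 1], [tau_star] is [+oo] and the beta-min condition is contradictory. *)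
have [t0|t0] := leP t 0.
  rewrite (@einv_le0 _ t)// (gt0_muley (x := ((1 + rho)%:E * einv (1 - rho)%:E)%E)).
    by rewrite gt0_muley ?lte_fin// gt0_mulye ?lte_fin.
  have [p0|p0] := leP (1 - rho) 0.
    by rewrite einv_le0// gt0_muley ?lte_fin//; lra.
  by rewrite einv_gt0// lte_fin mulr_gt0 ?invr_gt0//; lra.
rewrite (@einv_gt0 _ t)//.
have [p0|p0] := leP (1 - rho) 0.
  rewrite (einv_le0 p0) (@gt0_muley _ (1 + rho)%:E); last by rewrite lte_fin; lra.
  by rewrite gt0_mulye ?lte_fin ?invr_gt0// gt0_muley ?lte_fin// gt0_mulye ?lte_fin.
rewrite (@einv_gt0 _ (1 - rho))// -!EFinM lte_fin => hb.
have theta0 : 0 < theta by apply: lt_le_trans htheta.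
(* The threshold with each random quantity replaced by its deterministic bound; twice this value is
   the left side of beta-min. *)
exists (2 * (sig * ((1 + rho) / (1 - rho))) * r * (ckk * vk)^-1 * t^-1); last first.
  by apply: le_lt_trans hb; lra.
rewrite (einv_gt0 (mulr_gt0 kap0 Xk0)) (einv_gt0 theta0) -!EFinM lee_fin.
have hsh : sh <= sig * ((1 + rho) / (1 - rho)).
  rewrite mulrA ler_pdivlMr//; apply: (le_trans hs).
  by rewrite ler_wpM2r//; lra.
have i1 : (kap * Xk)^-1 <= (ckk * vk)^-1.
  rewrite lef_pV2 ?posrE ?mulr_gt0//.
  by rewrite ler_pM// ltW.
have i2 : theta^-1 <= t^-1 by rewrite lef_pV2 ?posrE.
apply: ler_pM => //.
- by rewrite !mulr_ge0 ?invr_ge0// ?mulr_ge0// ltW.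
- by rewrite invr_ge0 ltW.
apply: ler_pM => //.
- by rewrite !mulr_ge0// ltW.
- by rewrite invr_ge0 mulr_ge0// ltW.
by rewrite (ler_pM2r r0) (ler_pM2l (ltr0Sn _ 1)).
Qed.

(** On the support [|bh k| >= |b k| - W > W], so the coordinate is kept, and its error is below
    [|b k|], so the sign is right. Off the support [bh k] is pure error, at most the threshold, and
    is set to 0. *)
Lemma sign_recovery :
  let bt := thresholded c r s kend X Z bh sh in
  (forall k, Num.sg (bt k) = Num.sg (b k)) /\ supp bt = J.
Proof.
move=> bt; have sgE k : Num.sg (bt k) = Num.sg (b k).
  rewrite /bt /thresholded; have := dist_le_omega k.
  have [kinJ|] := boolP (k \in J).
    have [W] := omega_lt_half kinJ.
    move: (omega_thr _ _ _ _ _ _ _ _) => o oW W2 oD.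
    have DW : `|bh k - b k| <= W by rewrite -lee_fin (le_trans oD).
    rewrite ifT; last first.
      rewrite (le_lt_trans oW)// lte_fin.
      have : `|b k| <= `|bh k - b k| + `|bh k|.
        by rewrite distrC -lerBlDr; exact: lerB_dist.
      lra.
    apply: sgr_close; have := normr_ge0 (bh k - b k); lra.
  by rewrite inE negbK => /eqP ->; rewrite subr0 ltNge => ->; rewrite sgr0.
split => //; apply/setP => k.
by rewrite !inE -sgr_eq0 sgE sgr_eq0.
Qed.

End SignRecovery.

(** * Intersection of the probability events *)

Theorem theorem3 (R : realType) (d : measure_display) (T : measurableType d)
  (P : probability T R)
  (n K L kend : nat)
  (y u : 'I_n -> T -> R) (x : 'I_n -> 'I_K -> T -> R) (z : 'I_n -> 'I_L -> T -> R)
  (bstar : 'I_K -> R)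
  (c delta A A0 : R) (s : nat)
  (sigstar gam1 gam2 gam3 : R) (v : 'I_K -> R)
  (cJ cend cendc : R) (ck : 'I_K -> R) :
  (* setting *)
  (0 < n)%N -> (0 < L)%N -> (K <= L)%N -> (kend <= K)%N ->
  (forall i, measurable_fun setT (y i)) ->
  (forall i, measurable_fun setT (u i)) ->
  (forall i k, measurable_fun setT (x i k)) ->
  (forall i l, measurable_fun setT (z i l)) ->
  (forall i w, y i w = \sum_(k < K) x i k w * bstar k + u i w) ->
  mutually_indep P (fun i => sigma_of
     [set f | [\/ f = y i, f = u i, (exists k, f = x i k) | (exists l, f = z i l)]]) ->
  (forall (i : 'I_n) (l : 'I_L) (k : 'I_K),
      nat_of_ord k = (kend + nat_of_ord l)%N -> z i l = x i k) ->
  0 < c < 1 ->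
  (* Assumption 1 and the conditions of Theorem 1 *)
  0 < delta <= 1 ->
  (forall i l, (\int[P]_w ((`|z i l w * u i w| `^ (2 + delta))%R%:E) < +oo)%E) ->
  (forall i l, ((\int[P]_w (z i l w * u i w)%R%:E) = 0)%E) ->
  (forall i l, (0 < P [set w | (z i l w * u i w != 0)%R])%E) ->
  1 <= A ->
  JSW_constant A0 ->
  let dn := fine (\big[Order.min/+oo%E]_(l < L)
                   (dnd1 P (fun i w => z i l w * u i w) delta)%:E) in
  let r := A * Num.sqrt (2 * ln (L%:R) / n%:R) in
  let alpha := 2 * L%:R * (1 - Phi (A * Num.sqrt (2 * ln (L%:R))))
       + 2 * A0 * (1 + A * Num.sqrt (2 * ln (L%:R))) `^ (1 + delta)
         / (L%:R `^ (A ^+ 2 - 1) * dn `^ (2 + delta)) in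
  L%:R <= expR (dn ^+ 2 / (2 * A ^+ 2)) ->
  (* Assumption 2 *)
  0 < sigstar -> 0 < gam1 < 1 ->
  (exists E, [/\ measurable E, ((1 - gam1)%:E <= P E)%E &
     forall w, E w -> n%:R^-1 * \sum_(i < n) (u i w) ^+ 2 <= sigstar ^+ 2]) ->
  (* Assumption 4 *)
  (forall k, 0 < v k) -> 0 < gam3 < 1 ->
  (exists E, [/\ measurable E, ((1 - gam3)%:E <= P E)%E &
     forall w, E w -> forall k, k \in supp bstar ->
       v k <= colmax (fun i k => x i k w) k]) ->
  (* Assumption 5 *)
  (1 <= s)%N ->
  0 < cJ -> 0 < cend -> 0 < cendc -> (forall k, 0 < ck k) -> 0 < gam2 < 1 ->
  (exists E, [/\ measurable E, ((1 - gam2)%:E <= P E)%E &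
     forall w, E w ->
       let Psi := PsiN (fun i k => x i k w) (fun i l => z i l w) in
       let Jend := [set j : 'I_K | (j < kend)%N]%SET in
       [/\ (cJ%:E <= kappaJJ Psi c (supp bstar) (supp bstar))%E,
           (forall k, ((ck k)%:E <= kappas Psi c s [set k]%SET)%E),
           (cend%:E <= kappas Psi c s Jend)%E &
           (cendc%:E <= kappas Psi c s (~: Jend))%E]]) ->
  (* sparsity and beta-min *)
  (#|supp bstar| <= s)%N ->
  (forall k, k \in supp bstar ->
     ((4 * sigstar * r)%:E * tau_star c r cJ cend cendc * einv (ck k * v k)%:E
        < (`|bstar k|)%:E)%E) ->
  (* conclusion *)
  exists E, [/\ measurable E,
    ((1 - (alpha + gam1 + gam2 + gam3))%:E <= P E)%E &
    forall w, E w ->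
      let X := fun i k => x i k w in
      let Z := fun i l => z i l w in
      let Y := fun i => y i w in
      forall bh sh, is_STIV c r Y X Z bh sh ->
        let bt := thresholded c r s kend X Z bh sh in
        (forall k, Num.sg (bt k) = Num.sg (bstar k)) /\ supp bt = supp bstar].
Proof.
move=> n0 L0 KL _ my mu mx mz yE ind zx c01 d01 momX meanX nzX A1 JSW dn r alpha Ldn sig0 /andP[g1 _].
move=> [E2 [mE2 PE2 hE2]] v0 /andP[g3 _] [E4 [mE4 PE4 hE4]] s1.
move=> cJ0 cend0 cendc0 ck0 /andP[g2 _] [E5 [mE5 PE5 hE5]].
move=> Js beta_min.
pose X l i w := z i l w * u i w.
have [dn0 dnX] : 0 <= dn /\ forall l, dn <= dnd1 P (X l) delta.
  have M0 : (0 <= \big[Order.min/+oo]_(l < L) (dnd1 P (X l) delta)%:E)%E.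
    by apply: le_bigmin => [|l _]; rewrite ?leey// lee_fin dnd1_ge0.
  have Ml l : (\big[Order.min/+oo]_(l < L) (dnd1 P (X l) delta)%:E <= (dnd1 P (X l) delta)%:E)%E.
    exact: (bigmin_le _ l (fun l => (dnd1 P (X l) delta)%:E)).
  split; first exact: fine_ge0.
  (* The minimum has default [+oo], which [fine] would send to 0; an index [l] makes it finite. *)
  move=> l; rewrite -lee_fin fineK ?Ml// ge0_fin_numE//.
  by apply: le_lt_trans (Ml l) _; rewrite ltry.
have mX l i : measurable_fun setT (X l i) by apply: measurable_funM.
have indX l : mutually_indep P (fun i => sigma_of [set X l i]).
  apply: mutually_indep_sub ind => i; apply: sigma_of_mul; first by constructor 4; exists l.
  by constructor 2.
(* For [L = 1] the required probability is at most 0, and the empty event suffices. *)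
have [L1|L1] := leqP L 1.
  have LE : L%:R = 1 :> R by rewrite (_ : L = 1%N)//; apply/eqP; rewrite eqn_leq L1.
  have alpha1 : 1 <= alpha.
    rewrite /alpha LE; apply: alpha1_ge1 => //; last by case/andP: d01.
    move=> dn1; pose l := Ordinal L0; have d1 := lt_le_trans dn1 (dnX l).
    have t0 : 0 <= (0 : R) <= dnd1 P (X l) delta by apply/andP; split=> //; exact: ltW.
    exact: (JSW_constant_ge0 JSW n0 d01 (mX l) (indX l) (fun i => meanX i l)
      (fun i => momX i l) (fun i => nzX i l) t0).
  exists set0; split => //; rewrite measure0 lee_fin; lra.
(* If [dn] were 0, the growth condition would read [L <= 1]. *)
have dn1 : 0 < dn.
  rewrite lt_def dn0 andbT; apply: contraTneq Ldn => ->.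
  by rewrite expr0n mul0r expR0 -ltNge ltr1n.
have [G mG [PG hG]] := @score_event _ _ _ P n L X A0 A delta dn JSW n0 L0 d01 A1 mX indX
  (fun l i => meanX i l) (fun l i => momX i l) (fun l i => nzX i l) dn1 dnX Ldn.
exists (G `&` E2 `&` E5 `&` E4); split.
- by apply: measurableI => //; apply: measurableI => //; apply: measurableI.
- apply: probability_setI_ge => //; first by apply: measurableI => //; exact: measurableI.
  apply: probability_setI_ge => //; first exact: measurableI.
  exact: probability_setI_ge.
move=> w [[[Gw E2w] E5w] E4w] XX ZZ YY bh sh stiv.
have [hJ hk hend hendc] := hE5 _ E5w.
have ninv0 : 0 <= n%:R^-1 :> R by rewrite invr_ge0.
have r0 : 0 < r.
  rewrite mulr_gt0 ?sqrtr_gt0 ?divr_gt0 ?mulr_gt0 ?ltr0n// ?ln_gt0 ?ltr1n//.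
  by rewrite (lt_le_trans ltr01).
pose q := Num.sqrt (n%:R^-1 * \sum_(i < n) u i w ^+ 2).
have qE : n%:R^-1 * \sum_(i < n) u i w ^+ 2 = q ^+ 2.
  by rewrite sqr_sqrtr// mulr_ge0// sumr_ge0// => i _; exact: sqr_ge0.
have score l : `|n%:R^-1 * \sum_(i < n) ZZ i l * u i w|
    <= r * Num.sqrt (n%:R^-1 * \sum_(i < n) (ZZ i l * u i w) ^+ 2).
  rewrite normrM (ger0_norm ninv0); apply: (le_trans (ler_wpM2l ninv0 (hG w Gw l))).
  have lnL : 0 <= 2 * ln (L%:R : R) by rewrite mulr_ge0// ln_ge0// ler1n.
  (* The factor [1/n] is shared equally: one square root turns [t] into [r], the other turns the sum
     of squares into a mean. *)
  have nS : Num.sqrt n%:R^-1 * Num.sqrt n%:R^-1 = n%:R^-1 :> R by rewrite -expr2 sqr_sqrtr.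
  rewrite /r (sqrtrM _ lnL) (sqrtrM _ ninv0) -[X in X * _ <= _]nS.
  by rewrite /XX /X; lra.
apply: (sign_recovery (u := fun i => u i w) (sig := sigstar) (v := v) (q := q) n0 KL
  (fun i => yE i w) _ c01 r0 _ qE score stiv s1 Js _ _ cJ0 cend0 cendc0 v0 ck0 (hE4 _ E4w) hJ hk hend hendc) => //.
- by move=> l k lk i; rewrite /ZZ /XX (zx i l k lk).
- exact: sqrtr_ge0.
- rewrite -[leRHS](gtr0_norm sig0) -sqrtr_sqr ler_wsqrtr//; exact: hE2.
Qed.
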